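(* Let $f:[0,1]\times\mathbb{R}^8\to\mathbb{R}$ be continuous, $a,b,c,d\in\mathbb{R}$, $M>0$, and let $g$, $M_i$, $\mathcal{D}_M$, $G_i$ be as in the context. Assume: (i) $\varphi_k:[0,1]\to[0,1]$ ($k=0,1,2,3$) are continuous; (ii) $|f|\le M$ on $\mathcal{D}_M$; (iii) on $\mathcal{D}_M$ the function $f(t,u,\bar u,y,\bar y,v,\bar v,z,\bar z)$ is Lipschitz in $u,\bar u,y,\bar y,v,\bar v,z,\bar z$ with coefficients $L_0,\dots,L_7\ge0$ respectively, i.e. the difference of its values at two points of $\mathcal{D}_M$ with the same $t$ is at most, in absolute value, $L_0|u_2-u_1|+L_1|\bar u_2-\bar u_1|+L_2|y_2-y_1|+L_3|\bar y_2-\bar y_1|+L_4|v_2-v_1|+L_5|\bar v_2-\bar v_1|+L_6|z_2-z_1|+L_7|\bar z_2-\bar z_1|$; (iv) $q:=(L_0+L_1)M_0+(L_2+L_3)M_1+(L_4+L_5)M_2+(L_6+L_7)M_3<1$. Let $\psi_0\in C[0,1]$ with $\|\psi_0\|\le M$ (for example $\psi_0(t)=f(t,0,0,0,0,0,0,0,0)$), and for $k=0,1,2,\dots$ define $$\begin{aligned} u_k(t)&=g(t)+\int_0^1G_0(t,s)\psi_k(s)\,ds, & \bar u_k(t)&=g(\varphi_0(t))+\int_0^1G_0(\varphi_0(t),s)\psi_k(s)\,ds,\\ y_k(t)&=g'(t)+\int_0^1G_1(t,s)\psi_k(s)\,ds, & \bar y_k(t)&=g'(\varphi_1(t))+\int_0^1G_1(\varphi_1(t),s)\psi_k(s)\,ds,\\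 v_k(t)&=g''(t)+\int_0^1G_2(t,s)\psi_k(s)\,ds, & \bar v_k(t)&=g''(\varphi_2(t))+\int_0^1G_2(\varphi_2(t),s)\psi_k(s)\,ds,\\ z_k(t)&=g'''(t)+\int_0^1G_3(t,s)\psi_k(s)\,ds, & \bar z_k(t)&=g'''(\varphi_3(t))+\int_0^1G_3(\varphi_3(t),s)\psi_k(s)\,ds, \end{aligned}$$ $$\psi_{k+1}(t)=f\big(t,u_k(t),\bar u_k(t),y_k(t),\bar y_k(t),v_k(t),\bar v_k(t),z_k(t),\bar z_k(t)\big).$$ Then this iterative method converges and, for all $k\ge0$, $$\|u_k^{(i)}-u^{(i)}\|\le M_i\,p_k\,\mathbf{d},\qquad i=0,1,2,3,\qquad\text{where } p_k=\frac{q^k}{1-q},\quad \mathbf{d}=\|\psi_1-\psi_0\|,$$ and $u$ is the exact solution of the boundary value problem stated in the context.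
   Context: The boundary value problem is $$u''''(t)=f\big(t,u(t),u(\varphi_0(t)),u'(t),u'(\varphi_1(t)),u''(t),u''(\varphi_2(t)),u'''(t),u'''(\varphi_3(t))\big),\ 0<t<1,$$ $$u(0)=a,\ u(1)=b,\ u'(0)=c,\ u'(1)=d.$$ Its exact solution $u\in C^4[0,1]$ is the unique one satisfying $|u^{(i)}(t)|\le\|g^{(i)}\|+M_iM$ on $[0,1]$ for $i=0,1,2,3$ (it exists and is unique under (i)–(iv)). Here $\|v\|=\max_{0\le t\le1}|v(t)|$; $g$ is the polynomial of degree at most three with $g(0)=a$, $g(1)=b$, $g'(0)=c$, $g'(1)=d$; $M_0=\frac1{384}$, $M_1=\frac1{72\sqrt3}$, $M_2=\frac1{12}$, $M_3=\frac12$; and $$\mathcal{D}_M=\Big\{(t,u,\bar u,y,\bar y,v,\bar v,z,\bar z)\ \Big|\ 0\le t\le1;\ |u|,|\bar u|\le\|g\|+M_0M;\ |y|,|\bar y|\le\|g'\|+M_1M;\ |v|,|\bar v|\le\|g''\|+M_2M;\ |z|,|\bar z|\le\|g'''\|+M_3M\Big\}.$$ The Green function of $u''''=\psi$ with homogeneous conditions $u(0)=u(1)=u'(0)=u'(1)=0$ is $$G_0(t,s)=G(t,s)=\frac16\begin{cases}s^2(1-t)^2(3t-s-2ts),&0\le s\le t\le1,\\ t^2(1-s)^2(3s-t-2ts),&0\le t\le s\le1,\end{cases}$$ and $G_i(t,s)=\partial^iG(t,s)/\partial t^i$, $i=1,2,3$; in particular $G_3(t,s)=s^2(3-2s)$ for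 $s<t$ and $G_3(t,s)=s^2(3-2s)-1$ for $t<s$. *)

(* Defs.v *)
(* Functions on [0,1] are total functions [R -> R]
   of which only the values on [0,1] matter: continuity, derivatives and norms
   below are all taken relative to [0,1] (one-sided at the end points). *)
From Stdlib Require Import Reals.
From Coquelicot Require Import Coquelicot.
Open Scope R_scope.

Definition I01 (t : R) : Prop := 0 <= t <= 1.

(* Coquelicot's [is_derive] is this with [locally t] as filter. *)
Definition is_derive01 (v : R -> R) (t l : R) : Prop :=
  filterdiff (K := R_AbsRing) (U := R_NormedModule) (V := R_NormedModule)
    v (within I01 (locally t)) (fun h => scal h l).

(* Unspecified where the derivative does not exist, like [Derive]. *)
Definition Derive01 (v : R -> R) (t : R) : R :=
  iota (T := R_CompleteSpace) (is_derive01 v t).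

Fixpoint Derive01_n (v : R -> R) (n : nat) : R -> R :=
  match n with
  | O => v
  | S m => Derive01 (Derive01_n v m)
  end.

Definition C01 (v : R -> R) : Prop := continuous_on I01 v.

Definition Cn01 (n : nat) (v : R -> R) : Prop :=
  (forall i : nat, (i < n)%nat -> forall t : R, I01 t ->
     exists l : R, is_derive01 (Derive01_n v i) t l) /\
  (forall i : nat, (i <= n)%nat -> C01 (Derive01_n v i)).

(* Valued in [Rbar]: it is [p_infty] for a function unbounded on [0,1], and the
   maximum of [Rabs (v t)] for a function continuous on [0,1]. *)
Definition norm01 (v : R -> R) : Rbar :=
  Lub_Rbar (fun y => exists t : R, I01 t /\ y = Rabs (v t)).

Definition green (t s : R) : R :=
  (if Rle_dec s t
   then s ^ 2 * (1 - t) ^ 2 * (3 * t - s - 2 * t * s)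
   else t ^ 2 * (1 - s) ^ 2 * (3 * s - t - 2 * t * s)) / 6.

(* [Green 3 t t] is an unspecified real for 0 < t < 1, where the third
   derivative does not exist; a single point does not affect the integrals. *)
Definition Green (i : nat) (t s : R) : R :=
  Derive01_n (fun t' => green t' s) i t.

(* Used for [i <= 3] only. *)
Definition Mcoef (i : nat) : R :=
  match i with
  | O => 1 / 384
  | 1%nat => 1 / (72 * sqrt 3)
  | 2%nat => 1 / 12
  | _ => 1 / 2
  end.

Definition is_boundary_cubic (a b c d : R) (g : R -> R) : Prop :=
  (exists p : nat -> R, forall t : R, g t = sum_n (fun i => p i * t ^ i) 3) /\
  g 0 = a /\ g 1 = b /\ Derive01 g 0 = c /\ Derive01 g 1 = d.

(* Tuples (t, u, ubar, y, ybar, v, vbar, z, zbar). *)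
Definition point : Type := (R * R * R * R * R * R * R * R * R)%type.

Definition strip (p : point) : Prop :=
  let '(t, _, _, _, _, _, _, _, _) := p in I01 t.

(* The radius is finite since the derivatives of [g] are bounded on [0,1]. *)
Definition radius (g : R -> R) (M : R) (i : nat) : R :=
  real (norm01 (Derive01_n g i)) + Mcoef i * M.

Definition DM (g : R -> R) (M : R) (p : point) : Prop :=
  let '(t, u, ub, y, yb, v, vb, z, zb) := p in
  I01 t /\
  (Rabs u <= radius g M 0 /\ Rabs ub <= radius g M 0) /\
  (Rabs y <= radius g M 1 /\ Rabs yb <= radius g M 1) /\
  (Rabs v <= radius g M 2 /\ Rabs vb <= radius g M 2) /\
  (Rabs z <= radius g M 3 /\ Rabs zb <= radius g M 3).

Definition lipschitz_on_DM (f : point -> R) (g : R -> R) (M : R)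
    (L : nat -> R) : Prop :=
  forall t u1 ub1 y1 yb1 v1 vb1 z1 zb1 u2 ub2 y2 yb2 v2 vb2 z2 zb2 : R,
  DM g M (t, u1, ub1, y1, yb1, v1, vb1, z1, zb1) ->
  DM g M (t, u2, ub2, y2, yb2, v2, vb2, z2, zb2) ->
  Rabs (f (t, u2, ub2, y2, yb2, v2, vb2, z2, zb2)
        - f (t, u1, ub1, y1, yb1, v1, vb1, z1, zb1))
  <= L 0%nat * Rabs (u2 - u1) + L 1%nat * Rabs (ub2 - ub1)
     + L 2%nat * Rabs (y2 - y1) + L 3%nat * Rabs (yb2 - yb1)
     + L 4%nat * Rabs (v2 - v1) + L 5%nat * Rabs (vb2 - vb1)
     + L 6%nat * Rabs (z2 - z1) + L 7%nat * Rabs (zb2 - zb1).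

Definition contraction (L : nat -> R) : R :=
  (L 0%nat + L 1%nat) * Mcoef 0 + (L 2%nat + L 3%nat) * Mcoef 1
  + (L 4%nat + L 5%nat) * Mcoef 2 + (L 6%nat + L 7%nat) * Mcoef 3.

(* The argument of [f] built from a function and its derivatives [h i], each
   taken at [t] and at the deviated argument [phi i t]. *)
Definition jet (phi h : nat -> R -> R) (t : R) : point :=
  (t, h 0%nat t, h 0%nat (phi 0%nat t), h 1%nat t, h 1%nat (phi 1%nat t),
      h 2%nat t, h 2%nat (phi 2%nat t), h 3%nat t, h 3%nat (phi 3%nat t)).

Definition is_bvp_solution (f : point -> R) (phi : nat -> R -> R)
    (a b c d : R) (u : R -> R) : Prop :=
  Cn01 4 u /\
  (forall t : R, 0 < t < 1 -> Derive01_n u 4 t = f (jet phi (Derive01_n u) t)) /\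
  u 0 = a /\ u 1 = b /\ Derive01 u 0 = c /\ Derive01 u 1 = d.

Definition is_exact_solution (f : point -> R) (phi : nat -> R -> R)
    (a b c d : R) (g : R -> R) (M : R) (u : R -> R) : Prop :=
  is_bvp_solution f phi a b c d u /\
  (forall (i : nat) (t : R), (i <= 3)%nat -> I01 t ->
     Rabs (Derive01_n u i t) <= radius g M i).

(* For [i] = 0, 1, 2, 3 these are u, y, v, z as functions of [psi]. *)
Definition approx (g psi : R -> R) (i : nat) (t : R) : R :=
  Derive01_n g i t + RInt (fun s => Green i t s * psi s) 0 1.

Fixpoint iter_psi (f : point -> R) (phi : nat -> R -> R) (g psi0 : R -> R)
    (k : nat) : R -> R :=
  match k with
  | O => psi0
  | S m => fun t => f (jet phi (approx g (iter_psi f phi g psi0 m)) t)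
  end.

Definition iter_u (f : point -> R) (phi : nat -> R -> R) (g psi0 : R -> R)
    (k : nat) : R -> R :=
  approx g (iter_psi f phi g psi0 k) 0.

(* Main.v *)
Require Import Defs.
From Stdlib Require Import Reals Lra Lia.
From Coquelicot Require Import Coquelicot.
Open Scope R_scope.

(* Through [psi = f (jet phi (Derive01_n u))] the solutions [u] correspond to
   the fixed points of [T psi = f (jet phi (approx g psi))].  The integral of
   [|G_i (t, .)|] being at most [M_i], the operator [T] maps the ball of radius
   [M] of C[0,1] to itself and contracts it with ratio [q]; its Picard iterates
   are within [p_k d] of the fixed point, and the integral bounds applied once
   more give the errors on the derivatives of [u].  For these bounds, [G_i (t, s)]
   is [s ^ 2] or [(1 - s) ^ 2] times an affine function of [s], whose absolute
   value is bounded by its chord. *)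

(** [Derive01] is a choice operator, so an iterated derivative is known only once a formula for it
    has been exhibited and proved to be a derivative. Hence functions are handled through towers [W]
    in which [W (S i)] is the derivative of [W i] on [0,1]. For the integrals of G_i against psi the
    obstacle is the jump of G_3 across the diagonal. Integration by parts expresses them through
    iterated primitives of psi, whose derivatives are immediate and do not involve the kernel; to
    this end psi is extended to a continuous function on the line. The constants: M_0 is the maximum
    of t^2 (1 - t)^2 / 24, the solution of u'''' = 1 with homogeneous conditions, and M_1 that of
    its derivative; M_2 and M_3 are the integrals of |G_2 (0, .)| and |G_3 (0, .)|. Uniqueness holds
    among the solutions whose jets stay in D_M, the only place where f is controlled. *)

(** * Derivatives relative to [0,1] *)

Lemma within_I01_filter_lim (t x : R) :
  I01 t -> is_filter_lim (within I01 (locally t)) x -> x = t.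
Proof.
  intros Ht Hx.
  destruct (Req_dec x t) as [E|E]; [exact E|exfalso].
  assert (Hpos : 0 < Rabs (t - x)) by (apply Rabs_pos_lt; lra).
  specialize (Hx (ball x (mkposreal _ Hpos)) (locally_ball _ _)).
  apply locally_singleton in Hx.
  specialize (Hx Ht).
  change (Rabs (t - x) < Rabs (t - x)) in Hx; lra.
Qed.

Lemma is_derive01_iff (v : R -> R) (t l : R) : I01 t ->
  is_derive01 v t l <->
  forall eps : posreal, exists delta : posreal, forall y : R, I01 y ->
    Rabs (y - t) < delta ->
    Rabs (v y - v t - (y - t) * l) <= eps * Rabs (y - t).
Proof.
  intros Ht; split.
  - intros [_ H] eps.
    destruct (H t (filter_le_within I01) eps) as [delta Hd].
    exists delta; intros y Hy Hyt; exact (Hd y Hyt Hy).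
  - intros H; split.
    + apply (is_linear_scal_l (V := R_NormedModule) l).
    (* [filterdiff] asks for the estimate at every limit of the filter; this one has [t] as its only
       limit. *)
    + intros x Hx eps; apply within_I01_filter_lim in Hx; [subst x|exact Ht].
      destruct (H eps) as [delta Hd].
      exists delta; intros y Hyt Hy; exact (Hd y Hy Hyt).
Qed.

Lemma is_derive_is_derive01 (v : R -> R) (t l : R) :
  I01 t -> is_derive v t l -> is_derive01 v t l.
Proof.
  intros Ht [_ H]; apply is_derive01_iff; [exact Ht|]; intros eps.
  destruct (H t (fun P HP => HP) eps) as [delta Hd].
  exists delta; intros y _ Hyt; exact (Hd y Hyt).
Qed.

Lemma is_derive01_is_derive (v : R -> R) (t l : R) :
  0 < t < 1 -> is_derive01 v t l -> is_derive v t l.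
Proof.
  intros Ht H.
  assert (Ht' : I01 t) by (unfold I01; lra).
  rewrite is_derive01_iff in H by exact Ht'.
  split; [apply (is_linear_scal_l (V := R_NormedModule) l)|].
  intros x Hx eps; apply (is_filter_lim_locally_unique (V := R_NormedModule)) in Hx; subst x.
  destruct (H eps) as [delta Hd].
  assert (Hpos : 0 < Rmin delta (Rmin t (1 - t))).
  { repeat apply Rmin_glb_lt; try lra; apply cond_pos. }
  exists (mkposreal _ Hpos); intros y Hy.
  change (Rabs (y - t) < Rmin delta (Rmin t (1 - t))) in Hy.
  apply Rmin_Rgt_l in Hy as [Hy1 Hy2]; apply Rmin_Rgt_l in Hy2 as [Hy2 Hy3].
  assert (I01 y) as HIy.
  { apply Rabs_def2 in Hy2; apply Rabs_def2 in Hy3; unfold I01; lra. }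
  exact (Hd y HIy Hy1).
Qed.

Lemma is_derive01_unique (v : R -> R) (t l1 l2 : R) :
  I01 t -> is_derive01 v t l1 -> is_derive01 v t l2 -> l1 = l2.
Proof.
  intros Ht H1 H2.
  rewrite is_derive01_iff in H1, H2 by exact Ht.
  destruct (Req_dec l1 l2) as [E|E]; [exact E|exfalso].
  assert (Hpos : 0 < Rabs (l1 - l2) / 3).
  { assert (0 < Rabs (l1 - l2)) by (apply Rabs_pos_lt; lra); lra. }
  destruct (H1 (mkposreal _ Hpos)) as [d1 Hd1].
  destruct (H2 (mkposreal _ Hpos)) as [d2 Hd2]; simpl in Hd1, Hd2.
  (* Since [e] is at most 1/2, one of [t + e] and [t - e] lies in [0,1]. There the two estimates add
     up to two thirds of [Rabs (l1 - l2) * e], a contradiction. *)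
  set (e := Rmin (Rmin d1 d2) 1 / 2).
  assert (He : 0 < e /\ e < d1 /\ e < d2 /\ e <= 1 / 2).
  { assert (Hd1p := cond_pos d1); assert (Hd2p := cond_pos d2).
    assert (0 < Rmin (Rmin d1 d2) 1) by (repeat apply Rmin_glb_lt; lra).
    assert (Ha := Rmin_l (Rmin d1 d2) 1); assert (Hb := Rmin_r (Rmin d1 d2) 1).
    assert (Hc := Rmin_l d1 d2); assert (Hd := Rmin_r d1 d2).
    unfold e; lra. }
  assert (exists y, I01 y /\ Rabs (y - t) = e) as [y [Hy Hyt]].
  { destruct (Rle_dec t (1 / 2)) as [Hle|Hle].
    - exists (t + e); unfold I01 in *; split; [lra|].
      rewrite Rabs_right; lra.
    - exists (t - e); unfold I01 in *; split; [lra|].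
      rewrite Rabs_left; lra. }
  assert (K1 := Hd1 y Hy ltac:(lra)); assert (K2 := Hd2 y Hy ltac:(lra)).
  assert (K : Rabs ((l1 - l2) * (y - t)) <= 2 * (Rabs (l1 - l2) / 3 * Rabs (y - t))).
  { replace ((l1 - l2) * (y - t)) with
      ((v y - v t - (y - t) * l2) - (v y - v t - (y - t) * l1)) by ring.
    eapply Rle_trans; [apply Rabs_triang|]; rewrite Rabs_Ropp; lra. }
  rewrite Rabs_mult, Hyt in K.
  assert (0 < Rabs (l1 - l2) * e) by (apply Rmult_lt_0_compat; lra).
  lra.
Qed.

Lemma Derive01_unique (v : R -> R) (t l : R) :
  I01 t -> is_derive01 v t l -> Derive01 v t = l.
Proof.
  intros Ht H.
  apply (iota_unique (V := R_CompleteNormedModule)); [|exact H].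
  intros y Hy; exact (is_derive01_unique v t y l Ht Hy H).
Qed.

Lemma is_derive01_ext_loc (v w : R -> R) (t l : R) : I01 t ->
  locally t (fun y => I01 y -> v y = w y) ->
  is_derive01 v t l -> is_derive01 w t l.
Proof.
  intros Ht [d Hd] H.
  rewrite is_derive01_iff in H |- * by exact Ht.
  intros eps; destruct (H eps) as [d' Hd'].
  assert (Hpos : 0 < Rmin d d') by (apply Rmin_glb_lt; apply cond_pos).
  exists (mkposreal _ Hpos); intros y Hy Hyt; simpl in Hyt.
  apply Rmin_Rgt_l in Hyt as [H1 H2].
  rewrite <- (Hd y H1 Hy), <- (Hd t (ball_center _ _) Ht).
  exact (Hd' y Hy H2).
Qed.

(* [D] is the whole line for functions smooth on [0,1], and one side of the
   diagonal for the Green function. *)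
Lemma Derive01_n_eq (D : R -> Prop) (v : R -> R) (W : nat -> R -> R) (n : nat) :
  open D ->
  (forall t, I01 t -> D t -> v t = W 0%nat t) ->
  (forall i t, (i < n)%nat -> I01 t -> D t -> is_derive01 (W i) t (W (S i) t)) ->
  forall i, (i <= n)%nat -> forall t, I01 t -> D t -> Derive01_n v i t = W i t.
Proof.
  intros HD H0 HS; induction i as [|i IH]; intros Hi t Ht Dt.
  - exact (H0 t Ht Dt).
  - apply Derive01_unique; [exact Ht|].
    apply is_derive01_ext_loc with (W i); [exact Ht| |apply HS; auto; lia].
    apply filter_imp with D; [|exact (HD t Dt)].
    intros y Dy Hy; symmetry; apply IH; auto; lia.
Qed.

Lemma is_derive01_tower (v : R -> R) (W : nat -> R -> R) (n : nat) :
  (forall t, I01 t -> v t = W 0%nat t) ->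
  (forall i t, (i < n)%nat -> I01 t -> is_derive01 (W i) t (W (S i) t)) ->
  forall i t, (i < n)%nat -> I01 t ->
  is_derive01 (Derive01_n v i) t (W (S i) t).
Proof.
  intros H0 HS i t Hi Ht.
  apply is_derive01_ext_loc with (W i); auto.
  apply filter_forall; intros y Hy; symmetry.
  apply Derive01_n_eq with (fun _ => True) n; auto; [apply open_true|lia].
Qed.

(** * Continuity on [0,1] and extension to the line *)

Lemma C01_iff (v : R -> R) :
  C01 v <-> forall t, I01 t -> forall eps : posreal, exists delta : posreal,
    forall y, I01 y -> Rabs (y - t) < delta -> Rabs (v y - v t) < eps.
Proof.
  split; intros H t Ht.
  - intros eps; specialize (H t Ht).
    destruct (proj1 (filterlim_locally _ _) H eps) as [d Hd]; exists d.
    intros y Hy Hyt; exact (Hd y Hyt Hy).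
  - apply filterlim_locally; intros eps; destruct (H t Ht eps) as [d Hd].
    exists d; intros y Hyt Hy; exact (Hd y Hy Hyt).
Qed.

Lemma C01_ext (v w : R -> R) :
  (forall t, I01 t -> v t = w t) -> C01 v -> C01 w.
Proof.
  intros E; rewrite !C01_iff; intros H t Ht eps.
  destruct (H t Ht eps) as [d Hd]; exists d; intros y Hy Hyt.
  rewrite <- !E by assumption; auto.
Qed.

Lemma continuous_C01 (v : R -> R) :
  (forall t, I01 t -> continuous v t) -> C01 v.
Proof.
  intros H t Ht; apply (filterlim_filter_le_1 (F := locally t)).
  - apply filter_le_within.
  - exact (H t Ht).
Qed.

Lemma Cn01_tower (v : R -> R) (W : nat -> R -> R) (n : nat) :
  (forall t, I01 t -> v t = W 0%nat t) ->
  (forall i t, (i < n)%nat -> I01 t -> is_derive01 (W i) t (W (S i) t)) ->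
  (forall i, (i <= n)%nat -> C01 (W i)) ->
  Cn01 n v.
Proof.
  intros H0 HS HC; split.
  - intros i Hi t Ht; exists (W (S i) t); apply is_derive01_tower with n; auto.
  - intros i Hi; apply C01_ext with (W i); [|auto].
    intros t Ht; symmetry; apply Derive01_n_eq with (fun _ => True) n; auto; apply open_true.
Qed.

(** The nearest-point retraction onto [0,1]. Composition with it turns continuity relative to [0,1]
    into continuity on the line, where the theorems on integrals, extrema and mean values apply. *)
Definition clamp (t : R) : R := Rmax 0 (Rmin 1 t).

Lemma clamp_I01 (t : R) : I01 (clamp t).
Proof.
  unfold clamp, I01, Rmax, Rmin.
  destruct (Rle_dec 1 t); destruct (Rle_dec 0 _); lra.
Qed.

Lemma clamp_id (t : R) : I01 t -> clamp t = t.
Proof.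
  unfold clamp, I01, Rmax, Rmin; intros Ht.
  destruct (Rle_dec 1 t); destruct (Rle_dec 0 _); lra.
Qed.

Lemma clamp_contract (x y : R) : Rabs (clamp x - clamp y) <= Rabs (x - y).
Proof.
  unfold clamp, Rmax, Rmin.
  destruct (Rle_dec 1 x); destruct (Rle_dec 1 y);
    repeat destruct (Rle_dec 0 _); unfold Rabs; repeat destruct Rcase_abs; lra.
Qed.

Lemma continuous_clamp (v : R -> R) (t : R) :
  C01 v -> continuous (fun s => v (clamp s)) t.
Proof.
  intros H; rewrite C01_iff in H; apply filterlim_locally; intros eps.
  destruct (H (clamp t) (clamp_I01 t) eps) as [d Hd].
  exists d; intros y Hy; apply (Hd _ (clamp_I01 y)).
  eapply Rle_lt_trans; [apply clamp_contract|exact Hy].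
Qed.

Lemma C01_bounded (v : R -> R) :
  C01 v -> exists B, forall t, I01 t -> Rabs (v t) <= B.
Proof.
  intros H.
  destruct (continuity_ab_maj (fun s => Rabs (v (clamp s))) 0 1) as [m [Hm _]].
  - lra.
  - intros c _; apply continuity_pt_filterlim.
    apply (continuous_comp (fun s => v (clamp s)) Rabs).
    + apply continuous_clamp, H.
    + apply continuous_Rabs.
  - exists (Rabs (v (clamp m))); intros t Ht.
    rewrite <- (clamp_id t Ht) at 1; exact (Hm t Ht).
Qed.

(** * The uniform norm *)

Lemma norm01_le (v : R -> R) (B : R) :
  (forall t, I01 t -> Rabs (v t) <= B) -> Rbar_le (norm01 v) B.
Proof.
  intros H; apply (proj2 (Lub_Rbar_correct _)).
  intros x [t [Ht ->]]; exact (H t Ht).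
Qed.

Lemma le_norm01 (v : R -> R) (t : R) :
  I01 t -> Rbar_le (Rabs (v t)) (norm01 v).
Proof.
  intros Ht; apply (proj1 (Lub_Rbar_correct _)); exists t; auto.
Qed.

(** [real] sends both infinities to 0, so a norm can be used as a real number only after finiteness
    is known: [B] excludes [p_infty], and the value at 0 excludes [m_infty]. *)
Lemma norm01_finite (v : R -> R) (B : R) :
  (forall t, I01 t -> Rabs (v t) <= B) -> is_finite (norm01 v).
Proof.
  intros H; assert (Hub := norm01_le v B H).
  assert (Hlb := le_norm01 v 0 ltac:(unfold I01; lra)).
  destruct (norm01 v); [reflexivity|easy|easy].
Qed.

Lemma le_real_norm01 (v : R -> R) (B t : R) :
  (forall s, I01 s -> Rabs (v s) <= B) -> I01 t ->
  Rabs (v t) <= real (norm01 v).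
Proof.
  intros H Ht; assert (Hle := le_norm01 v t Ht).
  rewrite <- (norm01_finite v B H) in Hle; exact Hle.
Qed.

Lemma real_norm01_le (v : R -> R) (B : R) :
  (forall t, I01 t -> Rabs (v t) <= B) -> real (norm01 v) <= B.
Proof.
  intros H; assert (Hle := norm01_le v B H).
  rewrite <- (norm01_finite v B H) in Hle; exact Hle.
Qed.

(** * Iterated primitives *)

Lemma is_RInt_ext_le (f g : R -> R) (a b l : R) : a <= b ->
  (forall s, a < s < b -> f s = g s) -> is_RInt f a b l -> is_RInt g a b l.
Proof.
  intros Hab E; apply is_RInt_ext; intros s.
  rewrite Rmin_left, Rmax_right by exact Hab; apply E.
Qed.

(** For n >= 1 and continuous [h] this is Cauchy's repeated integral, of (t - s)^(n-1) / (n-1)! h(s)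
    over [0,t]. *)
Fixpoint RInt_iter (h : R -> R) (n : nat) (t : R) : R :=
  match n with
  | O => h t
  | S m => RInt (RInt_iter h m) 0 t
  end.

(** The two claims feed each other: continuity at level n gives the derivative at level n + 1, which
    gives continuity there. *)
Lemma RInt_iter_derive_continuous (h : R -> R) :
  (forall t, continuous h t) ->
  forall n t, is_derive (RInt_iter h (S n)) t (RInt_iter h n t) /\ continuous (RInt_iter h n) t.
Proof.
  intros Hh.
  assert (HS : forall n, (forall t, continuous (RInt_iter h n) t) ->
    forall t, is_derive (RInt_iter h (S n)) t (RInt_iter h n t)).
  { intros n Hn t; apply is_derive_RInt with 0; [|apply Hn].
    apply filter_forall; intros y; apply (RInt_correct (RInt_iter h n)).
    apply (ex_RInt_continuous (RInt_iter h n)); intros z _; apply Hn. }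
  assert (HC : forall n t, continuous (RInt_iter h n) t).
  { induction n as [|n IH]; intros t; [apply Hh|].
    apply (ex_derive_continuous (RInt_iter h (S n))); exists (RInt_iter h n t); apply HS, IH. }
  intros n t; split; [apply HS, HC|apply HC].
Qed.

Lemma RInt_iter_0 (h : R -> R) (n : nat) : RInt_iter h (S n) 0 = 0.
Proof. exact (RInt_point 0 (RInt_iter h n)). Qed.

(* Repeated integration by parts. *)
Lemma is_RInt_cubic_mult (h : R -> R) (c0 c1 c2 c3 x y : R) :
  (forall t, continuous h t) ->
  let P := fun s =>
    (c0 + c1 * s + c2 * s ^ 2 + c3 * s ^ 3) * RInt_iter h 1 s
    - (c1 + 2 * c2 * s + 3 * c3 * s ^ 2) * RInt_iter h 2 s
    + (2 * c2 + 6 * c3 * s) * RInt_iter h 3 s - 6 * c3 * RInt_iter h 4 s in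
  is_RInt (fun s => (c0 + c1 * s + c2 * s ^ 2 + c3 * s ^ 3) * h s) x y
    (P y - P x).
Proof.
  intros Hh P.
  apply (is_RInt_derive P).
  - intros s _; unfold P.
    assert (H1 := proj1 (RInt_iter_derive_continuous h Hh 0 s)).
    assert (H2 := proj1 (RInt_iter_derive_continuous h Hh 1 s)).
    assert (H3 := proj1 (RInt_iter_derive_continuous h Hh 2 s)).
    assert (H4 := proj1 (RInt_iter_derive_continuous h Hh 3 s)).
    set (J1 := RInt_iter h 1) in *; set (J2 := RInt_iter h 2) in *.
    set (J3 := RInt_iter h 3) in *; set (J4 := RInt_iter h 4) in *.
    change (RInt_iter h 0 s) with (h s) in H1.
    clearbody J1 J2 J3 J4.
    auto_derive; [repeat split; eexists; eassumption|].
    replace (Derive (fun x0 => J1 x0) s) with (h s)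
      by (symmetry; apply is_derive_unique; exact H1).
    replace (Derive (fun x0 => J2 x0) s) with (J1 s)
      by (symmetry; apply is_derive_unique; exact H2).
    replace (Derive (fun x0 => J3 x0) s) with (J2 s)
      by (symmetry; apply is_derive_unique; exact H3).
    replace (Derive (fun x0 => J4 x0) s) with (J3 s)
      by (symmetry; apply is_derive_unique; exact H4).
    ring.
  - intros s _; apply (continuous_mult
      (fun s => c0 + c1 * s + c2 * s ^ 2 + c3 * s ^ 3) h); [|apply Hh].
    apply (ex_derive_continuous
      (fun s => c0 + c1 * s + c2 * s ^ 2 + c3 * s ^ 3)).
    auto_derive; auto.
Qed.

(** * The Green function and its integrals in closed form *)

(* [Green i t s] is [s ^ 2 * gl i t s] for [s < t] and [(1 - s) ^ 2 * gr i t s]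
   for [t < s]; both cofactors are affine in [s]. *)
Definition gl (i : nat) (t s : R) : R :=
  match i with
  | O => (1 - t) ^ 2 * (3 * t - s - 2 * t * s) / 6
  | 1%nat => (1 - t) * (1 - 3 * t + 2 * t * s) / 2
  | 2%nat => 3 * t - 2 + s * (1 - 2 * t)
  | _ => 3 - 2 * s
  end.

Definition gr (i : nat) (t s : R) : R :=
  match i with
  | O => t ^ 2 * (3 * s - t - 2 * t * s) / 6
  | 1%nat => t * (2 * s - t - 2 * t * s) / 2
  | 2%nat => s - t - 2 * t * s
  | _ => - (1 + 2 * s)
  end.

Lemma Green_left (i : nat) (t s : R) :
  (i <= 3)%nat -> I01 t -> s < t -> Green i t s = s ^ 2 * gl i t s.
Proof.
  intros Hi Ht Hst.
  apply (Derive01_n_eq (fun t => s < t) _ (fun i t => s ^ 2 * gl i t s) 3);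
    auto.
  - apply open_gt.
  - intros x _ Hx; unfold green; destruct (Rle_dec s x); [simpl; field|lra].
  - intros j x Hj HIx Hx; apply is_derive_is_derive01; [exact HIx|].
    destruct j as [|[|[|j]]]; [| | |lia]; simpl gl; auto_derive; auto; field.
Qed.

Lemma Green_right (i : nat) (t s : R) :
  (i <= 3)%nat -> I01 t -> t < s -> Green i t s = (1 - s) ^ 2 * gr i t s.
Proof.
  intros Hi Ht Hst.
  apply (Derive01_n_eq (fun t => t < s) _ (fun i t => (1 - s) ^ 2 * gr i t s) 3);
    auto.
  - apply open_lt.
  - intros x _ Hx; unfold green; destruct (Rle_dec s x); [lra|simpl; field].
  - intros j x Hj HIx Hx; apply is_derive_is_derive01; [exact HIx|].
    destruct j as [|[|[|j]]]; [| | |lia]; simpl gr; auto_derive; auto; field.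
Qed.

(* The integral of [G_i (t, s) h (s)] over [0,1], and [h] itself for [i = 4].
   The coefficients of the cubic are the moments of [h] against the part of the
   Green function for [t < s], which vanishes to second order at [s = 1]; on
   [s < t] the Green function exceeds that part by [(t - s) ^ 3 / 6]. *)
Definition potential (h : R -> R) (i : nat) (t : R) : R :=
  let j3 := RInt_iter h 3 1 in
  let j4 := RInt_iter h 4 1 in
  match i with
  | O => (t ^ 2 - t ^ 3) * j3 - (3 * t ^ 2 - 2 * t ^ 3) * j4 + RInt_iter h 4 t
  | 1%nat => (2 * t - 3 * t ^ 2) * j3 - (6 * t - 6 * t ^ 2) * j4 + RInt_iter h 3 t
  | 2%nat => (2 - 6 * t) * j3 - (6 - 12 * t) * j4 + RInt_iter h 2 t
  | 3%nat => - 6 * j3 + 12 * j4 + RInt_iter h 1 t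
  | _ => h t
  end.

Lemma potential_derive (h : R -> R) (i : nat) (t : R) :
  (forall s, continuous h s) -> (i < 4)%nat ->
  is_derive (potential h i) t (potential h (S i) t).
Proof.
  intros Hh Hi.
  assert (H1 := proj1 (RInt_iter_derive_continuous h Hh 0 t)).
  assert (H2 := proj1 (RInt_iter_derive_continuous h Hh 1 t)).
  assert (H3 := proj1 (RInt_iter_derive_continuous h Hh 2 t)).
  assert (H4 := proj1 (RInt_iter_derive_continuous h Hh 3 t)).
  unfold potential; generalize (RInt_iter h 3 1) (RInt_iter h 4 1); intros j3 j4.
  change (RInt_iter h 0 t) with (h t) in H1.
  set (J1 := RInt_iter h 1) in *; set (J2 := RInt_iter h 2) in *.
  set (J3 := RInt_iter h 3) in *; set (J4 := RInt_iter h 4) in *.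
  clearbody J1 J2 J3 J4.
  destruct i as [|[|[|[|i]]]]; [| | | |lia];
    (auto_derive; [repeat split; eexists; eassumption|]).
  - replace (Derive (fun x => J4 x) t) with (J3 t)
      by (symmetry; apply is_derive_unique; exact H4); ring.
  - replace (Derive (fun x => J3 x) t) with (J2 t)
      by (symmetry; apply is_derive_unique; exact H3); ring.
  - replace (Derive (fun x => J2 x) t) with (J1 t)
      by (symmetry; apply is_derive_unique; exact H2); ring.
  - replace (Derive (fun x => J1 x) t) with (h t)
      by (symmetry; apply is_derive_unique; exact H1); ring.
Qed.

(** The diagonal [s = t], where the closed forms say nothing, is an end point of both intervals, and
    the integrands are compared on the open intervals only. *)
Lemma is_RInt_Green_split (psi : R -> R) (i : nat) (t lA lB : R) :
  (i <= 3)%nat -> I01 t ->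
  is_RInt (fun s => s ^ 2 * gl i t s * psi s) 0 t lA ->
  is_RInt (fun s => (1 - s) ^ 2 * gr i t s * psi s) t 1 lB ->
  is_RInt (fun s => Green i t s * psi s) 0 1 (lA + lB).
Proof.
  intros Hi Ht HA HB; apply (is_RInt_Chasles (V := R_NormedModule) _ 0 t 1).
  - apply (is_RInt_ext_le (fun s => s ^ 2 * gl i t s * psi s)); [apply Ht| |exact HA].
    intros s Hs.
    rewrite Green_left by (auto; lra); reflexivity.
  - apply (is_RInt_ext_le (fun s => (1 - s) ^ 2 * gr i t s * psi s)); [apply Ht| |exact HB].
    intros s Hs.
    rewrite Green_right by (auto; lra); reflexivity.
Qed.

Lemma gl_affine (i : nat) (t s : R) :
  gl i t s = gl i t 0 + (gl i t 1 - gl i t 0) * s.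
Proof. destruct i as [|[|[|i]]]; simpl; field. Qed.

Lemma gr_affine (i : nat) (t s : R) :
  gr i t s = gr i t 0 + (gr i t 1 - gr i t 0) * s.
Proof. destruct i as [|[|[|i]]]; simpl; field. Qed.

Lemma is_RInt_Green (h : R -> R) (i : nat) (t : R) :
  (forall s, continuous h s) -> (i <= 3)%nat -> I01 t ->
  is_RInt (fun s => Green i t s * h s) 0 1 (potential h i t).
Proof.
  intros Hh Hi Ht.
  set (el := gl i t 1 - gl i t 0); set (er := gr i t 1 - gr i t 0).
  assert (HA := is_RInt_cubic_mult h 0 0 (gl i t 0) el 0 t Hh); cbv beta zeta in HA.
  (* The coefficients of [(1 - s) ^ 2 * (gr i t 0 + er * s)]. *)
  assert (HB := is_RInt_cubic_mult h (gr i t 0) (er - 2 * gr i t 0)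
    (gr i t 0 - 2 * er) er t 1 Hh); cbv beta zeta in HB.
  rewrite !RInt_iter_0 in HA.
  match type of HA with is_RInt _ _ _ ?lA =>
    match type of HB with is_RInt _ _ _ ?lB =>
      replace (potential h i t) with (lA + lB) end end.
  - apply is_RInt_Green_split; auto.
    + apply is_RInt_ext_le with (3 := HA); [apply Ht|]; intros s _.
      rewrite (gl_affine i t s); fold el; ring.
    + apply is_RInt_ext_le with (3 := HB); [apply Ht|]; intros s _.
      rewrite (gr_affine i t s); fold er; ring.
  (* The identity is algebraic in the values of the primitives at [t] and 1. At 1 the right cubic
     vanishes to second order, which leaves [J3] and [J4]. At [t] the two cubics differ by (t -
     s)^(3-i) / (3-i)!, which leaves the primitive of order 4 - i with coefficient 1. *)
  - unfold potential, el, er; clear - Hi.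
    generalize (RInt_iter h 1) (RInt_iter h 2) (RInt_iter h 3) (RInt_iter h 4); intros J1 J2 J3 J4.
    destruct i as [|[|[|[|i]]]]; [..|lia]; unfold gl, gr; field.
Qed.

(** * Bounds on the integral of the absolute value of the kernel *)

(* By convexity [|ell|] lies below its chord on [0,t], and is equal to it if
   [ell] has no sign change. *)
Lemma square_affine_integral_bound (ell psi : R -> R) (t N l : R) :
  0 <= t ->
  (forall s, t * ell s = (t - s) * ell 0 + s * ell t) ->
  (forall s, 0 <= s <= t -> Rabs (psi s) <= N) ->
  is_RInt (fun s => s ^ 2 * ell s * psi s) 0 t l ->
  Rabs l <= N * (t ^ 3 * (Rabs (ell 0) + 3 * Rabs (ell t)) / 12).
Proof.
  intros Ht Hell Hpsi HI.
  destruct (Req_dec t 0) as [->|Hne].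
  - assert (l = 0) as ->.
    { rewrite <- (is_RInt_unique _ _ _ _ HI); exact (RInt_point 0 _). }
    rewrite Rabs_R0; right; field.
  - assert (Htp : 0 < t) by lra; clear Ht Hne.
    set (p := Rabs (ell 0)); set (r := Rabs (ell t)).
    set (F := fun s => N * (p * s ^ 3 / 3 + (r - p) / t * s ^ 4 / 4)).
    replace (N * (t ^ 3 * (p + 3 * r) / 12)) with (F t - F 0)
      by (unfold F; field; lra).
    apply (norm_RInt_le (V := R_NormedModule) (fun s => s ^ 2 * ell s * psi s)
      (fun s => N * (s ^ 2 * ((t - s) * p + s * r) / t)) 0 t); [lra| |exact HI|].
    + intros s Hs.
      change (Rabs (s ^ 2 * ell s * psi s) <= N * (s ^ 2 * ((t - s) * p + s * r) / t)).
      assert (Hl : Rabs (ell s) <= ((t - s) * p + s * r) / t).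
      { apply Rmult_le_reg_l with t; [exact Htp|].
        replace (t * (((t - s) * p + s * r) / t)) with ((t - s) * p + s * r)
          by (field; lra).
        rewrite <- (Rabs_right t) at 1 by lra.
        rewrite <- Rabs_mult, Hell.
        eapply Rle_trans; [apply Rabs_triang|].
        rewrite !Rabs_mult, (Rabs_right (t - s)), (Rabs_right s) by lra.
        apply Rle_refl. }
      rewrite !Rabs_mult, (Rabs_right (s ^ 2)) by (apply Rle_ge, pow2_ge_0).
      replace (N * (s ^ 2 * ((t - s) * p + s * r) / t))
        with (s ^ 2 * (((t - s) * p + s * r) / t) * N) by (field; lra).
      apply Rmult_le_compat; [|apply Rabs_pos| |apply Hpsi, Hs].
      * apply Rmult_le_pos; [apply pow2_ge_0|apply Rabs_pos].
      * apply Rmult_le_compat_l; [apply pow2_ge_0|exact Hl].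
    + apply (is_RInt_derive F).
      * intros s _; unfold F; auto_derive; [auto|field; lra].
      * intros s _; apply (ex_derive_continuous
          (fun s => N * (s ^ 2 * ((t - s) * p + s * r) / t))).
        auto_derive; auto.
Qed.

(** The reflection turns the factor [(1 - s) ^ 2] on [t,1] into [s ^ 2] on [0,1-t], so one chord
    estimate serves both sides of the diagonal. *)
Lemma is_RInt_reflect (f : R -> R) (t l : R) :
  is_RInt f t 1 l -> is_RInt (fun s => f (1 - s)) 0 (1 - t) l.
Proof.
  intros H.
  assert (H1 : is_RInt f (-1 * (1 - t) + 1) (-1 * 0 + 1) l).
  { replace (-1 * (1 - t) + 1) with t by ring.
    replace (-1 * 0 + 1) with 1 by ring; exact H. }
  apply (is_RInt_comp_lin (V := R_NormedModule)), is_RInt_swap, is_RInt_opp in H1.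
  rewrite opp_opp in H1.
  apply is_RInt_ext with (2 := H1); intros s _.
  replace (-1 * s + 1) with (1 - s) by ring.
  change (- (-1 * f (1 - s)) = f (1 - s)); ring.
Qed.

(** The chord estimates of the two sides added up: a majorant of the integral of |G_i (t, .)|, equal
    to it when neither affine cofactor changes sign on its interval. *)
Definition kernel_mass (i : nat) (t : R) : R :=
  (t ^ 3 * (Rabs (gl i t 0) + 3 * Rabs (gl i t t))
   + (1 - t) ^ 3 * (Rabs (gr i t 1) + 3 * Rabs (gr i t t))) / 12.

Lemma RInt_Green_le_mass (psi : R -> R) (i : nat) (t N l : R) :
  (i <= 3)%nat -> I01 t -> (forall s, I01 s -> Rabs (psi s) <= N) ->
  is_RInt (fun s => Green i t s * psi s) 0 1 l ->
  Rabs l <= kernel_mass i t * N.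
Proof.
  intros Hi Ht HN HI.
  assert (Hex : ex_RInt (fun s => Green i t s * psi s) 0 1) by (eexists; apply HI).
  destruct (ex_RInt_Chasles_1 (V := R_CompleteNormedModule) _ 0 t 1 Ht Hex) as [lA HA].
  destruct (ex_RInt_Chasles_2 (V := R_CompleteNormedModule) _ 0 t 1 Ht Hex) as [lB HB].
  assert (l = lA + lB) as ->.
  { rewrite <- (is_RInt_unique _ _ _ _ HI).
    apply is_RInt_unique; exact (is_RInt_Chasles _ 0 t 1 _ _ HA HB). }
  apply (is_RInt_ext_le _ (fun s => s ^ 2 * gl i t s * psi s)) in HA;
    [|apply Ht|intros s Hs; rewrite Green_left; auto; lra].
  apply (is_RInt_ext_le _ (fun s => (1 - s) ^ 2 * gr i t s * psi s)) in HB;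
    [|apply Ht|intros s Hs; rewrite Green_right; auto; lra].
  apply is_RInt_reflect in HB.
  unfold I01 in *.
  apply square_affine_integral_bound with (N := N) in HA; [|lra| |].
  2:{ intros s; rewrite (gl_affine i t s), (gl_affine i t t); ring. }
  2:{ intros s Hs; apply HN; lra. }
  apply (is_RInt_ext_le _ (fun s => s ^ 2 * gr i t (1 - s) * psi (1 - s))) in HB;
    [|lra|intros s Hs; replace (1 - (1 - s)) with s by ring; reflexivity].
  apply (square_affine_integral_bound (fun s => gr i t (1 - s))
    (fun s => psi (1 - s)) _ N) in HB; [|lra| |].
  2:{ intros s; rewrite (gr_affine i t (1 - s)), (gr_affine i t (1 - 0)),
      (gr_affine i t (1 - (1 - t))); ring. }
  2:{ intros s Hs; apply HN; lra. }
  replace (1 - (1 - t)) with t in HB by ring.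
  replace (1 - 0) with 1 in HB by ring.
  eapply Rle_trans; [apply Rabs_triang|].
  unfold kernel_mass; lra.
Qed.

(** A rational substitute for M_1, for the values of [t] where the bound is not tight. *)
Lemma Mcoef_1_ge : 1 / 125 <= Mcoef 1.
Proof.
  assert (Hs : 0 < sqrt 3) by (apply sqrt_lt_R0; lra).
  assert (Hs2 : sqrt 3 * sqrt 3 = 3) by (apply sqrt_sqrt; lra).
  unfold Mcoef, Rdiv; rewrite !Rmult_1_l; apply Rinv_le_contravar; nra.
Qed.

(** The square of t (1 - t) (1 - 2 t) is y^2 (1 - 4 y) with y = t (1 - t). It is largest at y = 1/6,
    with value 1/108, the square of 1 / (6 sqrt 3); the double root there gives 1 - 108 y^2 (1 - 4
    y) = (1 - 6 y)^2 (1 + 12 y). *)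
Lemma cubic_le_Mcoef_1 (t : R) :
  I01 t -> t * (1 - t) * (1 - 2 * t) / 12 <= Mcoef 1.
Proof.
  intros Ht; unfold I01 in Ht.
  assert (Hs : 0 < sqrt 3) by (apply sqrt_lt_R0; lra).
  assert (Hs2 : sqrt 3 * sqrt 3 = 3) by (apply sqrt_sqrt; lra).
  set (x := t * (1 - t) * (1 - 2 * t)).
  set (y := t * (1 - t)).
  assert (Hx : x * x = y * y * (1 - 4 * y)) by (unfold x, y; ring).
  assert (Hy : 0 <= y) by (unfold y; nra).
  assert (H : 108 * (x * x) <= 1).
  { rewrite Hx; assert (0 <= (1 - 6 * y) * (1 - 6 * y) * (1 + 12 * y)).
    { apply Rmult_le_pos; [apply Rle_0_sqr|lra]. }
    lra. }
  assert (Hb : 6 * sqrt 3 * x <= 1).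
  { assert (E : (6 * sqrt 3 * x) * (6 * sqrt 3 * x) = 108 * (x * x)).
    { transitivity (36 * (sqrt 3 * sqrt 3) * (x * x)); [ring|rewrite Hs2; ring]. }
    apply Rnot_lt_le; intros Hgt.
    assert (1 * 1 < (6 * sqrt 3 * x) * (6 * sqrt 3 * x))
      by (apply Rmult_gt_0_lt_compat; lra).
    lra. }
  unfold Mcoef; apply Rmult_le_reg_r with (72 * sqrt 3); [lra|].
  replace (1 / (72 * sqrt 3) * (72 * sqrt 3)) with 1 by (field; lra).
  lra.
Qed.

Lemma kernel_mass_le (i : nat) (t : R) :
  (i <= 3)%nat -> I01 t -> kernel_mass i t <= Mcoef i.
Proof.
  intros Hi Ht; assert (HM := Mcoef_1_ge); assert (HC := cubic_le_Mcoef_1 t Ht).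
  assert (HC' := cubic_le_Mcoef_1 (1 - t) ltac:(unfold I01 in *; lra)).
  unfold I01 in Ht.
  set (r := 1 - t); assert (Hr : 0 <= r) by (unfold r; lra).
  assert (Hy : t * r <= 1 / 4)
    by (assert (H := pow2_ge_0 (t - 1 / 2)); unfold r; lra).
  assert (Hy0 : 0 <= t * r) by (apply Rmult_le_pos; lra).
  destruct i as [|[|[|[|i]]]]; [| | | |lia]; unfold kernel_mass, gl, gr.
  - fold r; replace (r ^ 2 * (3 * t - 0 - 2 * t * 0) / 6) with (t * r ^ 2 / 2) by field.
    replace (r ^ 2 * (3 * t - t - 2 * t * t) / 6) with (t * r ^ 3 / 3)
      by (unfold r; field).
    replace (t ^ 2 * (3 * 1 - t - 2 * t * 1) / 6) with (t ^ 2 * r / 2)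
      by (unfold r; field).
    replace (t ^ 2 * (3 * t - t - 2 * t * t) / 6) with (t ^ 3 * r / 3)
      by (unfold r; field).
    assert (Ht2 := pow_le t 2 ltac:(lra)); assert (Ht3 := pow_le t 3 ltac:(lra)).
    assert (Hr2 := pow_le r 2 Hr); assert (Hr3 := pow_le r 3 Hr).
    rewrite !Rabs_right by (apply Rle_ge; apply Rmult_le_pos; [|lra]; apply Rmult_le_pos; lra).
    unfold Mcoef.
    (* G_0 is nonnegative, so its mass is the solution of u'''' = 1; the maximum is at
       [t = 1 / 2]. *)
    replace (_ / 12) with ((t * r) ^ 2 / 24) by (unfold r; field).
    nra.
  - fold r; replace (r * (1 - 3 * t + 2 * t * 0) / 2) with (r * (1 - 3 * t) / 2) by field.
    replace (r * (1 - 3 * t + 2 * t * t) / 2) with (r ^ 2 * (1 - 2 * t) / 2)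
      by (unfold r; field).
    replace (t * (2 * 1 - t - 2 * t * 1) / 2) with (t * (2 - 3 * t) / 2) by field.
    replace (t * (2 * t - t - 2 * t * t) / 2) with (t ^ 2 * (1 - 2 * t) / 2) by field.
    unfold Rdiv; rewrite !Rabs_mult, (Rabs_right (/ 2)), (Rabs_right t),
      (Rabs_right r), (Rabs_right (r ^ 2)), (Rabs_right (t ^ 2))
      by (try apply Rle_ge, pow2_ge_0; lra).
    (* The end values of the cofactors change sign at 1/3, 1/2 and 2/3. On the two outer intervals
       all signs agree and the mass is exactly t r |1 - 2 t| / 12. On the inner ones a cofactor
       changes sign and the chord overshoots, but there is room. The upper half mirrors the lower
       one under exchange of [t] and [r]. *)
    destruct (Rle_dec t (1 / 3)); [|destruct (Rle_dec t (1 / 2));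
      [|destruct (Rle_dec t (2 / 3))]].
    + rewrite !Rabs_right by lra.
      eapply Rle_trans; [|exact HC]; right; unfold r; field.
    + rewrite (Rabs_left1 (1 - 3 * t)), !Rabs_right by lra.
      eapply Rle_trans; [|exact HM].
      apply Rle_trans with (t * r * (1 - 2 * t - t ^ 2 + 3 * t ^ 3) / 12);
        [right; unfold r; field|].
      (* This product is 1/3 minus the last factor; with t r <= 1/4 the mass is then at most
         1/144. *)
      assert (0 <= (t - 1 / 3) * (2 - 3 * t ^ 2)) by (apply Rmult_le_pos; nra).
      assert (1 - 2 * t - t ^ 2 + 3 * t ^ 3 <= 1 / 3) by lra.
      nra.
    + rewrite (Rabs_right (2 - 3 * t)), !Rabs_left1 by lra.
      eapply Rle_trans; [|exact HM].
      apply Rle_trans with (t * r * (1 - 2 * r - r ^ 2 + 3 * r ^ 3) / 12);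
        [right; unfold r; field|].
      assert (0 <= (r - 1 / 3) * (2 - 3 * r ^ 2))
        by (apply Rmult_le_pos; unfold r; nra).
      assert (1 - 2 * r - r ^ 2 + 3 * r ^ 3 <= 1 / 3) by lra.
      nra.
    + rewrite !Rabs_left1 by lra.
      eapply Rle_trans; [|exact HC']; right; unfold r; field.
  - replace (3 * t - 2 + 0 * (1 - 2 * t)) with (3 * t - 2) by ring.
    replace (3 * t - 2 + t * (1 - 2 * t)) with (- (2 * r ^ 2)) by (unfold r; ring).
    replace (1 - t - 2 * t * 1) with (1 - 3 * t) by (unfold r; ring).
    replace (t - t - 2 * t * t) with (- (2 * t ^ 2)) by ring.
    fold r; rewrite (Rabs_Ropp (2 * r ^ 2)), (Rabs_Ropp (2 * t ^ 2)),
      (Rabs_right (2 * r ^ 2)), (Rabs_right (2 * t ^ 2))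
      by (apply Rle_ge, Rmult_le_pos; [lra|apply pow2_ge_0]).
    (* Convexity again: [1 + r] and [1 + t] are the chords over [0,1] of the two absolute values. *)
    assert (H : Rabs (3 * t - 2) <= 1 + r).
    { unfold Rabs; destruct Rcase_abs; unfold r; lra. }
    assert (H0 : Rabs (1 - 3 * t) <= 1 + t).
    { unfold Rabs; destruct Rcase_abs; unfold r; lra. }
    assert (Ht3 := pow_le t 3 ltac:(lra)); assert (Hr3 := pow_le r 3 Hr).
    assert (H1 := Rmult_le_compat_l _ _ _ Ht3 H).
    assert (H2 := Rmult_le_compat_l _ _ _ Hr3 H0).
    assert (H3 : 0 <= t * r * (2 * t ^ 2 + 2 * r ^ 2)).
    { apply Rmult_le_pos; [exact Hy0|].
      assert (G1 := pow2_ge_0 t); assert (G2 := pow2_ge_0 r); lra. }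
    (* Made homogeneous by t + r = 1, the bound on 12 times the mass falls short of (t + r)^4 by
       exactly the product in [H3]. *)
    assert (E : 1 = (t + r) ^ 4) by (unfold r; ring).
    unfold Mcoef; replace t with (1 - r) in E, H1, H2, H3 |- * by (unfold r; ring).
    lra.
  - fold r; rewrite (Rabs_right (3 - 2 * 0)), (Rabs_right (3 - 2 * t)),
      (Rabs_left (- (1 + 2 * 1))), (Rabs_left (- (1 + 2 * t))) by lra.
    unfold Mcoef; unfold r in *.
    (* This product is exactly 1/2 minus the mass. *)
    assert (0 <= t * (1 - t) * (1 + t * (1 - t))) by (apply Rmult_le_pos; lra).
    lra.
Qed.

(** * The linear problem u'''' = psi *)

Lemma C01_plus (v w : R -> R) : C01 v -> C01 w -> C01 (fun t => v t + w t).
Proof.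
  intros Hv Hw t Ht; apply (filterlim_comp_2 (G := locally (v t)) (H := locally (w t))).
  - exact (Hv t Ht).
  - exact (Hw t Ht).
  - apply (filterlim_plus (V := R_NormedModule)).
Qed.

Lemma C01_minus (v w : R -> R) : C01 v -> C01 w -> C01 (fun t => v t - w t).
Proof.
  intros Hv Hw; apply C01_plus; [exact Hv|].
  intros t Ht; apply (filterlim_comp _ _ _ w Ropp _ (locally (w t))).
  - exact (Hw t Ht).
  - apply (filterlim_opp (V := R_NormedModule)).
Qed.

Lemma C01_comp (v w : R -> R) :
  C01 v -> C01 w -> (forall t, I01 t -> I01 (w t)) -> C01 (fun t => v (w t)).
Proof.
  rewrite !C01_iff; intros Hv Hw Hm t Ht eps.
  destruct (Hv (w t) (Hm t Ht) eps) as [d1 H1].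
  destruct (Hw t Ht d1) as [d2 H2].
  exists d2; intros y Hy Hyt; apply H1; auto.
Qed.

(** The mean value theorem for the clamped difference, which is continuous on the line and has
    derivative 0 inside the interval. *)
Lemma eq_derive_eq_const (v w : R -> R) : C01 v -> C01 w ->
  (forall t, 0 < t < 1 -> exists l, is_derive v t l /\ is_derive w t l) ->
  forall t, I01 t -> v t - w t = v 0 - w 0.
Proof.
  intros Hv Hw Hd t Ht.
  set (e := fun s => v (clamp s) - w (clamp s)).
  assert (I0 : I01 0) by (unfold I01; lra).
  destruct (MVT_gen e 0 t (fun _ => 0)) as [x [_ Hx]].
  - unfold I01 in Ht; rewrite Rmin_left, Rmax_right by lra; intros x Hx.
    destruct (Hd x ltac:(lra)) as [l [Hl1 Hl2]].
    apply is_derive_ext_loc with (fun s => v s - w s).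
    + assert (Hpos : 0 < Rmin x (1 - x)) by (apply Rmin_glb_lt; lra).
      exists (mkposreal _ Hpos); intros y Hy.
      change (Rabs (y - x) < Rmin x (1 - x)) in Hy.
      apply Rmin_Rgt_l in Hy as [H1 H2].
      apply Rabs_def2 in H1; apply Rabs_def2 in H2.
      unfold e; rewrite clamp_id by (unfold I01; lra); reflexivity.
    + replace 0 with (minus l l) by apply (minus_eq_zero (G := R_AbelianGroup)).
      exact (is_derive_minus v w x l l Hl1 Hl2).
  - intros x _; apply continuity_pt_filterlim.
    apply (continuous_minus (fun s => v (clamp s)) (fun s => w (clamp s)));
      apply continuous_clamp; assumption.
  - unfold e in Hx; rewrite !clamp_id in Hx by assumption; lra.
Qed.

Lemma boundary_cubic_tower (a b c d : R) (g : R -> R) :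
  is_boundary_cubic a b c d g ->
  exists G : nat -> R -> R,
    (forall t, g t = G 0%nat t) /\
    (forall i t, is_derive (G i) t (G (S i) t)) /\
    (forall t, G 4%nat t = 0) /\
    G 0%nat 0 = a /\ G 0%nat 1 = b /\ G 1%nat 0 = c /\ G 1%nat 1 = d.
Proof.
  intros [[p Hp] [Ha [Hb [Hc Hd]]]].
  set (G := fun (i : nat) (t : R) => match i with
    | O => p 0%nat + p 1%nat * t + p 2%nat * t ^ 2 + p 3%nat * t ^ 3
    | 1%nat => p 1%nat + 2 * p 2%nat * t + 3 * p 3%nat * t ^ 2
    | 2%nat => 2 * p 2%nat + 6 * p 3%nat * t
    | 3%nat => 6 * p 3%nat
    | _ => 0
    end).
  assert (H0 : forall t, g t = G 0%nat t).
  { intros t; rewrite Hp; rewrite !sum_Sn, sum_O; unfold plus; simpl; ring. }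
  assert (HG : forall i t, is_derive (G i) t (G (S i) t)).
  { intros i t; unfold G; destruct i as [|[|[|[|i]]]]; auto_derive; auto; ring. }
  assert (H1 : forall t, I01 t -> Derive01 g t = G 1%nat t).
  { intros t Ht; apply Derive01_unique, is_derive01_ext_loc with (G 0%nat); auto.
    - apply filter_forall; intros y _; symmetry; apply H0.
    - apply is_derive_is_derive01; auto. }
  exists G; split; [exact H0|split; [exact HG|]].
  rewrite <- !H0, <- !H1 by (unfold I01; lra); auto.
Qed.

Lemma Derive01_n_boundary_cubic_C01 (a b c d : R) (g : R -> R) (i : nat) :
  is_boundary_cubic a b c d g -> C01 (Derive01_n g i).
Proof.
  intros Hg; destruct (boundary_cubic_tower a b c d g Hg) as [G [H0 [HG _]]].
  apply (Cn01_tower g G i); auto.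
  - intros j t _ Ht; apply is_derive_is_derive01; auto.
  - intros j _; apply continuous_C01; intros t _.
    apply (ex_derive_continuous (G j)); eexists; apply HG.
Qed.

Lemma is_RInt_Green_clamp (psi : R -> R) (i : nat) (t : R) :
  C01 psi -> (i <= 3)%nat -> I01 t ->
  is_RInt (fun s => Green i t s * psi s) 0 1 (potential (fun s => psi (clamp s)) i t).
Proof.
  intros Hpsi Hi Ht.
  apply is_RInt_ext_le with (fun s => Green i t s * psi (clamp s)); [lra| |].
  - intros s Hs; rewrite clamp_id by (unfold I01; lra); reflexivity.
  - apply (is_RInt_Green (fun s => psi (clamp s))); auto.
    intros s; apply continuous_clamp, Hpsi.
Qed.

(** The tower is the cubic plus [potential h]. As [potential h 0] and [potential h 1] vanish at 0
    and 1, the boundary data come from the cubic alone. *)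
Lemma approx_tower (a b c d : R) (g psi : R -> R) :
  is_boundary_cubic a b c d g -> C01 psi ->
  exists W : nat -> R -> R,
    (forall i t, (i <= 3)%nat -> I01 t -> approx g psi i t = W i t) /\
    (forall i t, (i < 4)%nat -> I01 t -> is_derive01 (W i) t (W (S i) t)) /\
    (forall i, (i <= 4)%nat -> C01 (W i)) /\
    (forall t, I01 t -> W 4%nat t = psi t) /\
    W 0%nat 0 = a /\ W 0%nat 1 = b /\ W 1%nat 0 = c /\ W 1%nat 1 = d.
Proof.
  intros Hg Hpsi.
  destruct (boundary_cubic_tower a b c d g Hg)
    as [G [H0 [HG [HG4 [Ha [Hb [Hc Hd]]]]]]].
  set (h := fun s => psi (clamp s)).
  assert (Hh : forall s, continuous h s) by (intros s; apply continuous_clamp, Hpsi).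
  assert (HW : forall i t, (i < 4)%nat -> I01 t ->
    is_derive (fun t => G i t + potential h i t) t (G (S i) t + potential h (S i) t)).
  { intros i t Hi _; apply (is_derive_plus (G i) (potential h i)); [apply HG|].
    apply potential_derive; auto. }
  exists (fun i t => G i t + potential h i t).
  split; [|split; [|split; [|split; [|split; [|split; [|split]]]]]].
  - intros i t Hi Ht; unfold approx; f_equal.
    + apply Derive01_n_eq with (fun _ => True) 3%nat; auto; [apply open_true|].
      intros j s _ Hs _; apply is_derive_is_derive01; auto.
    + apply is_RInt_unique, is_RInt_Green_clamp; auto.
  - intros i t Hi Ht; apply is_derive_is_derive01; auto.
  - intros i Hi; apply continuous_C01; intros t Ht.
    destruct (Nat.eq_dec i 4) as [->|Hne].
    + apply (continuous_plus (G 4%nat) h); [|apply Hh].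
      apply (ex_derive_continuous (G 4%nat)); eexists; apply HG.
    + apply (ex_derive_continuous (fun t => G i t + potential h i t)).
      eexists; apply HW; auto; lia.
  - intros t Ht; rewrite HG4; simpl; unfold h; rewrite clamp_id by exact Ht; ring.
  - rewrite Ha; unfold potential; rewrite RInt_iter_0; ring.
  - rewrite Hb; unfold potential; ring.
  - rewrite Hc; unfold potential; rewrite RInt_iter_0; ring.
  - rewrite Hd; unfold potential; ring.
Qed.

(** Differentiation under the integral sign: in [approx g psi i] the derivatives fall on the kernel,
    and the tower identifies the result with a derivative of the integral. *)
Lemma approx_Derive01_n (a b c d : R) (g psi : R -> R) :
  is_boundary_cubic a b c d g -> C01 psi ->
  Cn01 4 (approx g psi 0) /\
  (forall i t, (i <= 3)%nat -> I01 t ->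
     Derive01_n (approx g psi 0) i t = approx g psi i t) /\
  (forall t, I01 t -> Derive01_n (approx g psi 0) 4 t = psi t) /\
  approx g psi 0 0 = a /\ approx g psi 0 1 = b /\
  Derive01 (approx g psi 0) 0 = c /\ Derive01 (approx g psi 0) 1 = d.
Proof.
  intros Hg Hpsi.
  destruct (approx_tower a b c d g psi Hg Hpsi)
    as [W [HA [HW [HC [H4 [Ha [Hb [Hc Hd]]]]]]]].
  assert (H0 : forall t, I01 t -> approx g psi 0 t = W 0%nat t)
    by (intros t; apply HA; lia).
  assert (HD : forall i t, (i <= 4)%nat -> I01 t ->
    Derive01_n (approx g psi 0) i t = W i t).
  { intros i t Hi Ht; apply Derive01_n_eq with (fun _ => True) 4%nat; auto.
    apply open_true. }
  assert (I0 : I01 0) by (unfold I01; lra).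
  assert (I1 : I01 1) by (unfold I01; lra).
  split; [|split; [|split; [|split; [|split; [|split]]]]].
  - apply Cn01_tower with W; auto.
  - intros i t Hi Ht; rewrite HA, HD; auto.
  - intros t Ht; rewrite HD; auto.
  - rewrite H0; auto.
  - rewrite H0; auto.
  - exact (eq_trans (HD 1%nat 0 ltac:(lia) I0) Hc).
  - exact (eq_trans (HD 1%nat 1 ltac:(lia) I1) Hd).
Qed.

Lemma Cn01_le (m n : nat) (v : R -> R) : (m <= n)%nat -> Cn01 n v -> Cn01 m v.
Proof.
  intros Hmn [H1 H2]; split.
  - intros i Hi; apply H1; lia.
  - intros i Hi; apply H2; lia.
Qed.

Lemma C01_approx (a b c d : R) (g psi : R -> R) (i : nat) :
  is_boundary_cubic a b c d g -> C01 psi -> (i <= 3)%nat -> C01 (approx g psi i).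
Proof.
  intros Hg Hpsi Hi.
  destruct (approx_tower a b c d g psi Hg Hpsi) as [W [HA [_ [HC _]]]].
  apply C01_ext with (W i); [|apply HC; lia].
  intros t Ht; symmetry; auto.
Qed.

Lemma RInt_Green_le (psi : R -> R) (i : nat) (t N l : R) :
  (i <= 3)%nat -> I01 t -> (forall s, I01 s -> Rabs (psi s) <= N) ->
  is_RInt (fun s => Green i t s * psi s) 0 1 l -> Rabs l <= Mcoef i * N.
Proof.
  intros Hi Ht HN HI.
  eapply Rle_trans; [apply (RInt_Green_le_mass psi i t N l); assumption|].
  apply Rmult_le_compat_r; [|apply kernel_mass_le; assumption].
  eapply Rle_trans; [apply Rabs_pos|apply (HN t Ht)].
Qed.

Lemma approx_diff_le (g psi chi : R -> R) (N : R) (i : nat) (t : R) :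
  C01 psi -> C01 chi -> (forall s, I01 s -> Rabs (psi s - chi s) <= N) ->
  (i <= 3)%nat -> I01 t ->
  Rabs (approx g psi i t - approx g chi i t) <= Mcoef i * N.
Proof.
  intros Hpsi Hchi HN Hi Ht; unfold approx.
  assert (H1 := is_RInt_Green_clamp psi i t Hpsi Hi Ht).
  assert (H2 := is_RInt_Green_clamp chi i t Hchi Hi Ht).
  assert (H3 := is_RInt_Green_clamp _ i t (C01_minus _ _ Hpsi Hchi) Hi Ht).
  apply (RInt_Green_le (fun s => psi s - chi s) i t N); auto.
  match goal with |- is_RInt _ _ _ (?x + ?y - (?x + ?z)) =>
    replace (x + y - (x + z)) with (minus y z)
      by (unfold minus, plus, opp; simpl; ring) end.
  rewrite (is_RInt_unique _ _ _ _ H1), (is_RInt_unique _ _ _ _ H2).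
  apply is_RInt_ext_le
    with (fun s => minus (Green i t s * psi s) (Green i t s * chi s)); [lra| |].
  - intros s _; unfold minus, plus, opp; simpl; ring.
  - exact (is_RInt_minus _ _ 0 1 _ _ H1 H2).
Qed.

(** The radii of D_M are chosen for this: the ball of radius M is sent into D_M, where the
    hypotheses on f hold. *)
Lemma approx_le_radius (a b c d : R) (g psi : R -> R) (M : R) (i : nat) (t : R) :
  is_boundary_cubic a b c d g -> C01 psi ->
  (forall s, I01 s -> Rabs (psi s) <= M) -> (i <= 3)%nat -> I01 t ->
  Rabs (approx g psi i t) <= radius g M i.
Proof.
  intros Hg Hpsi HM Hi Ht; unfold approx, radius.
  eapply Rle_trans; [apply Rabs_triang|]; apply Rplus_le_compat.
  - destruct (C01_bounded _ (Derive01_n_boundary_cubic_C01 a b c d g i Hg)) as [B HB].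
    apply le_real_norm01 with B; auto.
  - apply (RInt_Green_le psi i t); auto.
    apply (RInt_correct (V := R_CompleteNormedModule)).
    eexists; apply is_RInt_Green_clamp; auto.
Qed.

(** Uniqueness for the linear problem. The equation is given on the open interval only; continuity
    of the lower derivatives carries the conclusion to the end points. *)
Lemma Derive01_n_eq_approx (a b c d : R) (g psi w : R -> R) :
  is_boundary_cubic a b c d g -> C01 psi -> Cn01 4 w ->
  (forall t, 0 < t < 1 -> Derive01_n w 4 t = psi t) ->
  w 0 = a -> w 1 = b -> Derive01 w 0 = c -> Derive01 w 1 = d ->
  forall i t, (i <= 3)%nat -> I01 t -> Derive01_n w i t = approx g psi i t.
Proof.
  intros Hg Hpsi [Hex HDC] Hw4 wa wb wc wd.
  destruct (approx_tower a b c d g psi Hg Hpsi)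
    as [W [HA [HW [HC [H4 [Ha [Hb [Hc Hd]]]]]]]].
  set (D := Derive01_n w) in *.
  assert (I0 : I01 0) by (unfold I01; lra).
  assert (I1 : I01 1) by (unfold I01; lra).
  assert (HI : forall t, 0 < t < 1 -> I01 t) by (unfold I01; intros; lra).
  assert (HDd : forall i t, (i < 4)%nat -> 0 < t < 1 ->
    is_derive (D i) t (D (S i) t)).
  { intros i t Hi Ht; destruct (Hex i Hi t (HI t Ht)) as [l Hl].
    assert (E : D (S i) t = l) by exact (Derive01_unique _ t l (HI t Ht) Hl).
    rewrite E; apply is_derive01_is_derive; assumption. }
  assert (HWd : forall i t, (i < 4)%nat -> 0 < t < 1 ->
    is_derive (W i) t (W (S i) t)).
  { intros i t Hi Ht; apply is_derive01_is_derive; auto. }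
  (* Integrate [(w - u)'''' = 0] four times: [w - u] is a cubic. *)
  assert (step : forall (i : nat) (P dP : R -> R), (i < 4)%nat ->
    (forall t, is_derive P t (dP t)) -> P 0 = 0 ->
    (forall t, 0 < t < 1 -> D (S i) t = W (S i) t + dP t) ->
    forall t, I01 t -> D i t = W i t + ((D i 0 - W i 0) + P t)).
  { intros i P dP Hi HP HP0 Hd' t Ht.
    assert (E := eq_derive_eq_const (D i) (fun t => W i t + P t)).
    cbv beta in E; rewrite HP0 in E; enough (D i t - (W i t + P t) = D i 0 - (W i 0 + 0)) by lra.
    apply E; [apply HDC; lia|apply C01_plus|..|exact Ht].
    - apply HC; lia.
    - apply continuous_C01; intros s _; apply (ex_derive_continuous P).
      eexists; apply HP.
    - intros s Hs; exists (D (S i) s); split; [apply HDd; auto|].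
      rewrite Hd' by exact Hs.
      apply (is_derive_plus (W i) P); auto. }
  set (k3 := D 3%nat 0 - W 3%nat 0); set (k2 := D 2%nat 0 - W 2%nat 0).
  assert (E3 : forall t, I01 t -> D 3%nat t = W 3%nat t + k3).
  { intros t Ht; rewrite (step 3%nat (fun _ => 0) (fun _ => 0)); auto.
    - unfold k3; ring.
    - intros s; apply (is_derive_const 0).
    - intros s Hs; rewrite H4 by auto; unfold D; rewrite Hw4 by auto; ring. }
  assert (E2 : forall t, I01 t -> D 2%nat t = W 2%nat t + (k2 + k3 * t)).
  { intros t Ht; rewrite (step 2%nat (fun t => k3 * t) (fun _ => k3)); auto.
    - intros s; auto_derive; auto; ring.
    - ring. }
  assert (E1 : forall t, I01 t -> D 1%nat t = W 1%nat t + (k2 * t + k3 * t ^ 2 / 2)).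
  { intros t Ht; rewrite (step 1%nat (fun t => k2 * t + k3 * t ^ 2 / 2)
      (fun t => k2 + k3 * t)); auto.
    - change (D 1%nat 0) with (Derive01 w 0); rewrite wc, Hc; ring.
    - intros s; auto_derive; auto; field.
    - field. }
  assert (E0 : forall t, I01 t ->
    D 0%nat t = W 0%nat t + (k2 * t ^ 2 / 2 + k3 * t ^ 3 / 6)).
  { intros t Ht; rewrite (step 0%nat (fun t => k2 * t ^ 2 / 2 + k3 * t ^ 3 / 6)
      (fun t => k2 * t + k3 * t ^ 2 / 2)); auto.
    - change (D 0%nat 0) with (w 0); rewrite wa, Ha; ring.
    - intros s; auto_derive; auto; field.
    - field. }
  (* The conditions at 0 have removed two constants; those at 1 read k2/2 + k3/6 = 0 and k2 + k3/2 =
     0, a regular system. *)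
  assert (B0 := E0 1 I1); assert (B1 := E1 1 I1).
  change (D 0%nat 1) with (w 1) in B0; change (D 1%nat 1) with (Derive01 w 1) in B1.
  rewrite wb, Hb in B0; rewrite wd, Hd in B1.
  assert (k3 = 0) as Hk3 by lra; assert (k2 = 0) as Hk2 by lra.
  intros i t Hi Ht; rewrite HA by assumption.
  destruct i as [|[|[|[|i]]]]; [rewrite E0|rewrite E1|rewrite E2|rewrite E3|lia];
    auto; rewrite Hk3, ?Hk2; field.
Qed.

(** * Fixed points of contractions *)

Lemma is_lim_seq_geom_scal (q B : R) :
  0 <= q < 1 -> is_lim_seq (fun k => q ^ k * B) 0.
Proof.
  intros Hq; replace (Finite 0) with (Rbar_mult 0 B)
    by (simpl; rewrite Rmult_0_l; reflexivity).
  apply is_lim_seq_scal_r, is_lim_seq_geom; rewrite Rabs_right; lra.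
Qed.

Lemma le_geom_le_0 (q B x : R) :
  0 <= q < 1 -> (forall k : nat, x <= q ^ k * B) -> x <= 0.
Proof.
  intros Hq Hx.
  exact (is_lim_seq_le (fun _ => x) _ x 0 Hx (is_lim_seq_const x)
    (is_lim_seq_geom_scal q B Hq)).
Qed.

Lemma C01_uniform_limit (psi : nat -> R -> R) (chi : R -> R) (e : nat -> R) :
  (forall k, C01 (psi k)) ->
  (forall k t, I01 t -> Rabs (psi k t - chi t) <= e k) ->
  is_lim_seq e 0 -> C01 chi.
Proof.
  intros Hpsi He Hlim; rewrite C01_iff; intros t Ht eps.
  assert (Hpos : 0 < eps / 3) by (assert (H := cond_pos eps); lra).
  destruct (proj2 (is_lim_seq_spec e 0) Hlim (mkposreal _ Hpos)) as [n Hn].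
  specialize (Hn n (le_n n)); simpl in Hn; rewrite Rminus_0_r in Hn.
  apply Rabs_def2 in Hn.
  destruct (proj1 (C01_iff _) (Hpsi n) t Ht (mkposreal _ Hpos)) as [d Hd].
  exists d; intros y Hy Hyt; specialize (Hd y Hy Hyt); simpl in Hd.
  replace (chi y - chi t) with
    ((psi n y - psi n t) + ((psi n t - chi t) - (psi n y - chi y))) by ring.
  eapply Rle_lt_trans; [apply Rabs_triang|].
  assert (H1 := He n y Hy); assert (H2 := He n t Ht).
  assert (H3 := Rabs_triang (psi n t - chi t) (- (psi n y - chi y))).
  rewrite Rabs_Ropp in H3; unfold Rminus in H3 |- *; unfold Rminus in H1, H2, Hd; lra.
Qed.

(** Banach's theorem with the a priori error estimate. The uniform norm is replaced by pointwise
    inequalities on [0,1], since values elsewhere are arbitrary; fixed points and their uniqueness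
    are meant on [0,1] as well. *)
Lemma contraction_fixpoint (T : (R -> R) -> R -> R) (psi : nat -> R -> R)
    (q d M : R) :
  let K := fun chi => C01 chi /\ forall t, I01 t -> Rabs (chi t) <= M in
  0 <= q < 1 ->
  (forall k, psi (S k) = T (psi k)) ->
  K (psi 0%nat) ->
  (forall chi, K chi -> K (T chi)) ->
  (forall chi1 chi2 N, K chi1 -> K chi2 ->
     (forall t, I01 t -> Rabs (chi1 t - chi2 t) <= N) ->
     forall t, I01 t -> Rabs (T chi1 t - T chi2 t) <= q * N) ->
  (forall t, I01 t -> Rabs (psi 1%nat t - psi 0%nat t) <= d) ->
  (forall k, K (psi k)) /\
  exists chi, K chi /\
    (forall t, I01 t -> T chi t = chi t) /\
    (forall k t, I01 t -> Rabs (psi k t - chi t) <= q ^ k / (1 - q) * d) /\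
    (forall chi', K chi' -> (forall t, I01 t -> T chi' t = chi' t) ->
       forall t, I01 t -> chi' t = chi t).
Proof.
  intros K Hq HS H0 HT HC Hd.
  assert (HK : forall k, K (psi k)).
  { induction k as [|k IH]; [exact H0|rewrite HS; apply HT, IH]. }
  split; [exact HK|].
  assert (Hstep : forall k t, I01 t -> Rabs (psi (S k) t - psi k t) <= q ^ k * d).
  { induction k as [|k IH]; intros t Ht; [rewrite Rmult_1_l; apply Hd, Ht|].
    rewrite (HS (S k)), (HS k), <- tech_pow_Rmult, Rmult_assoc.
    apply HC; auto; rewrite <- HS; auto. }
  assert (Hd0 : 0 <= d).
  { eapply Rle_trans; [apply Rabs_pos|apply (Hd 0)]; unfold I01; lra. }
  set (e := fun k => q ^ k / (1 - q) * d).
  assert (Hdist : forall k m t, I01 t -> Rabs (psi (m + k)%nat t - psi k t) <= e k).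
  (* The finite geometric sum, kept exact so that the induction on [m] closes. *)
  { intros k m t Ht; apply Rle_trans with ((q ^ k - q ^ (m + k)) / (1 - q) * d).
    - induction m as [|m IH].
      + simpl; rewrite !Rminus_eq_0, Rabs_R0; unfold Rdiv; lra.
      + replace (psi (S m + k)%nat t - psi k t) with
          ((psi (S (m + k)) t - psi (m + k)%nat t) + (psi (m + k)%nat t - psi k t))
          by (simpl; ring).
        eapply Rle_trans; [apply Rabs_triang|].
        apply Rle_trans with (q ^ (m + k) * d + (q ^ k - q ^ (m + k)) / (1 - q) * d).
        * apply Rplus_le_compat; [apply Hstep, Ht|exact IH].
        * right; simpl; field; lra.
    - unfold e; apply Rmult_le_compat_r; [exact Hd0|].
      apply Rmult_le_compat_r; [apply Rlt_le, Rinv_0_lt_compat; lra|].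
      assert (0 <= q ^ (m + k)) by (apply pow_le; lra); lra. }
  assert (He : is_lim_seq e 0).
  { apply is_lim_seq_ext with (fun k => q ^ k * (d / (1 - q))).
    - intros k; unfold e; field; lra.
    - apply is_lim_seq_geom_scal, Hq. }
  set (chi := fun t => real (Lim_seq (fun k => psi k t))).
  assert (Hlim : forall t, I01 t -> is_lim_seq (fun k => psi k t) (chi t)).
  { intros t Ht; apply Lim_seq_correct', ex_lim_seq_cauchy_corr; intros eps.
    assert (Hpos : 0 < eps / 2) by (assert (H := cond_pos eps); lra).
    destruct (proj2 (is_lim_seq_spec e 0) He (mkposreal _ Hpos)) as [n Hn].
    specialize (Hn n (le_n n)); simpl in Hn; rewrite Rminus_0_r in Hn.
    apply Rabs_def2 in Hn.
    exists n; intros i j Hi Hj.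
    assert (H1 := Hdist n (i - n)%nat t Ht); assert (H2 := Hdist n (j - n)%nat t Ht).
    rewrite Nat.sub_add in H1, H2 by assumption.
    replace (psi i t - psi j t)
      with ((psi i t - psi n t) + - (psi j t - psi n t)) by ring.
    eapply Rle_lt_trans; [apply Rabs_triang|]; rewrite Rabs_Ropp; lra. }
  assert (Herr : forall k t, I01 t -> Rabs (psi k t - chi t) <= e k).
  { intros k t Ht; rewrite Rabs_minus_sym.
    apply (is_lim_seq_le (fun m => Rabs (psi (m + k)%nat t - psi k t))
      (fun _ => e k) (Rabs (chi t - psi k t)) (e k)).
    - intros m; apply Hdist, Ht.
    - apply (is_lim_seq_abs _ (chi t - psi k t)), is_lim_seq_minus'.
      + apply (is_lim_seq_incr_n (fun m => psi m t)), Hlim, Ht.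
      + apply is_lim_seq_const.
    - apply is_lim_seq_const. }
  assert (HKchi : K chi).
  { split.
    - apply C01_uniform_limit with psi e; auto; intros k; apply HK.
    - intros t Ht.
      apply (is_lim_seq_le (fun k => Rabs (psi k t)) (fun _ => M) (Rabs (chi t)) M).
      + intros k; apply HK, Ht.
      + apply (is_lim_seq_abs _ (chi t)), Hlim, Ht.
      + apply is_lim_seq_const. }
  assert (Hfixchi : forall t, I01 t -> T chi t = chi t).
  { intros t Ht; apply Rminus_diag_uniq.
    assert (Rabs (T chi t - chi t) <= 0) as Hle.
    (* The bound is [q * e k + e (S k)], from passing through [psi (S k) = T (psi k)]. *)
    { apply le_geom_le_0 with q (2 * q * (d / (1 - q))); [exact Hq|]; intros k.
      replace (T chi t - chi t) with
        (- (T (psi k) t - T chi t) + (psi (S k) t - chi t)) by (rewrite HS; ring).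
      eapply Rle_trans; [apply Rabs_triang|]; rewrite Rabs_Ropp.
      assert (H1 := HC _ _ _ (HK k) HKchi (Herr k) t Ht).
      assert (H2 := Herr (S k) t Ht).
      replace (q ^ k * (2 * q * (d / (1 - q)))) with (q * e k + e (S k))
        by (unfold e; simpl; field; lra).
      lra. }
    destruct (Req_dec (T chi t - chi t) 0) as [E|E]; [exact E|].
    apply Rabs_pos_lt in E; lra. }
  exists chi; split; [exact HKchi|split; [exact Hfixchi|split; [exact Herr|]]].
  intros chi' HK' Hfix t Ht; apply Rminus_diag_uniq.
    assert (Hk : forall k s, I01 s -> Rabs (chi' s - chi s) <= q ^ k * (M + M)).
    { induction k as [|k IH]; intros s Hs.
      - simpl; rewrite Rmult_1_l; unfold Rminus.
        eapply Rle_trans; [apply Rabs_triang|]; rewrite Rabs_Ropp.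
        apply Rplus_le_compat; [apply HK'|apply HKchi]; exact Hs.
      - rewrite <- Hfix, <- (Hfixchi s Hs), <- tech_pow_Rmult, Rmult_assoc by exact Hs.
        apply HC; auto. }
    assert (Hle := le_geom_le_0 q (M + M) _ Hq (fun k => Hk k t Ht)).
    destruct (Req_dec (chi' t - chi t) 0) as [E|E]; [exact E|].
    apply Rabs_pos_lt in E; lra.
Qed.

(** * The nonlinear operator and the convergence of the iteration *)

Lemma filterlim_pair_locally (S : Type) (U1 U2 : UniformSpace)
    (F : (S -> Prop) -> Prop) (u : S -> U1) (v : S -> U2) (x : U1) (y : U2) :
  Filter F -> filterlim u F (locally x) -> filterlim v F (locally y) ->
  filterlim (fun s => (u s, v s)) F
    (locally (T := prod_UniformSpace U1 U2) (x, y)).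
Proof.
  intros HF Hu Hv; apply filterlim_locally; intros eps.
  apply filter_and.
  - exact (proj1 (filterlim_locally u x) Hu eps).
  - exact (proj1 (filterlim_locally v y) Hv eps).
Qed.

Lemma C01_jet (f : point -> R) (phi h : nat -> R -> R) :
  continuous_on strip f ->
  (forall k, (k <= 3)%nat -> forall t, I01 t -> I01 (phi k t)) ->
  (forall k, (k <= 3)%nat -> C01 (phi k)) ->
  (forall i, (i <= 3)%nat -> C01 (h i)) ->
  C01 (fun t => f (jet phi h t)).
Proof.
  intros Hf Hm Hphi Hh t Ht.
  assert (Hhp : forall i, (i <= 3)%nat -> C01 (fun t => h i (phi i t))).
  { intros i Hi; apply C01_comp; auto. }
  apply (filterlim_comp _ _ _ (jet phi h) f _ (within strip (locally (jet phi h t)))).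
  - assert (Hjet : filterlim (jet phi h) (within I01 (locally t))
      (locally (jet phi h t))).
    { unfold jet; repeat apply filterlim_pair_locally; try apply within_filter, locally_filter;
        [apply (filter_le_within I01)
        | | | | | | | |]; (apply Hh || apply Hhp); auto; lia. }
    (* The first coordinate of the jet is the time itself, so for times in [0,1] the jet stays in
       [strip]: [HI] serves both restrictions. *)
    intros P HP; generalize (Hjet _ HP).
    apply (filter_imp (F := locally t)); intros y Hy HI; exact (Hy HI HI).
  - apply Hf; exact Ht.
Qed.

Lemma DM_jet (phi h : nat -> R -> R) (g : R -> R) (M t : R) :
  (forall k, (k <= 3)%nat -> forall t, I01 t -> I01 (phi k t)) ->
  (forall i, (i <= 3)%nat -> forall t, I01 t -> Rabs (h i t) <= radius g M i) ->
  I01 t -> DM g M (jet phi h t).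
Proof.
  intros Hm Hh Ht; unfold DM, jet; split; [exact Ht|].
  repeat split; apply Hh; try apply Hm; try lia; exact Ht.
Qed.

Lemma Mcoef_nonneg (i : nat) : 0 <= Mcoef i.
Proof.
  assert (0 < sqrt 3) by (apply sqrt_lt_R0; lra).
  destruct i as [|[|[|i]]]; simpl; try lra.
  apply Rlt_le, Rdiv_lt_0_compat; lra.
Qed.

Theorem theorem3p1
  (f : point -> R) (phi : nat -> R -> R) (a b c d M : R)
  (g : R -> R) (L : nat -> R) (psi0 : R -> R)
  (Hf : continuous_on strip f)
  (HM : 0 < M)
  (Hg : is_boundary_cubic a b c d g)
  (Hphi_maps : forall (k : nat) (t : R), (k <= 3)%nat -> I01 t -> I01 (phi k t))
  (Hphi_cont : forall k : nat, (k <= 3)%nat -> C01 (phi k))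
  (Hbound : forall p : point, DM g M p -> Rabs (f p) <= M)
  (HL : forall j : nat, (j <= 7)%nat -> 0 <= L j)
  (Hlip : lipschitz_on_DM f g M L)
  (Hq : contraction L < 1)
  (Hpsi0_cont : C01 psi0)
  (Hpsi0_bound : Rbar_le (norm01 psi0) M) :
  let psi := iter_psi f phi g psi0 in
  let uk := iter_u f phi g psi0 in
  let q := contraction L in
  let p := fun k : nat => q ^ k / (1 - q) in
  let dd := real (norm01 (fun t => psi 1%nat t - psi 0%nat t)) in
  (forall k : nat, Cn01 3 (uk k)) /\
  exists u : R -> R,
    is_exact_solution f phi a b c d g M u /\
    (forall w : R -> R, is_exact_solution f phi a b c d g M w ->
       forall t : R, I01 t -> w t = u t) /\
    (forall i : nat, (i <= 3)%nat ->
       is_lim_seq (fun k => real (norm01 (fun t =>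
         Derive01_n (uk k) i t - Derive01_n u i t))) 0) /\
    (forall k i : nat, (i <= 3)%nat ->
       Rbar_le (norm01 (fun t => Derive01_n (uk k) i t - Derive01_n u i t))
               (Finite (Mcoef i * p k * dd))).
Proof.
  intros psi uk q p dd.
  set (T := fun chi t => f (jet phi (approx g chi) t)).
  set (K := fun chi => C01 chi /\ forall t, I01 t -> Rabs (chi t) <= M).
  assert (HMcoef := Mcoef_nonneg).
  assert (Hq0 : 0 <= q < 1).
  { split; [|exact Hq]; unfold q, contraction.
    repeat apply Rplus_le_le_0_compat; apply Rmult_le_pos; auto;
      apply Rplus_le_le_0_compat; apply HL; lia. }
  assert (Happrox : forall chi, K chi -> forall i, (i <= 3)%nat ->
    forall t, I01 t -> Rabs (approx g chi i t) <= radius g M i).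
  { intros chi [H1 H2] i Hi t Ht.
    apply (approx_le_radius a b c d g chi M i t); assumption. }
  assert (HDM : forall chi, K chi -> forall t, I01 t ->
    DM g M (jet phi (approx g chi) t)).
  { intros chi HK t Ht; apply DM_jet; auto. }
  assert (HKT : forall chi, K chi -> K (T chi)).
  { intros chi HK; split.
    - apply C01_jet; auto; intros i Hi; apply (C01_approx a b c d); auto; apply HK.
    - intros t Ht; apply Hbound, HDM; assumption. }
  assert (HTlip : forall chi1 chi2 N, K chi1 -> K chi2 ->
    (forall t, I01 t -> Rabs (chi1 t - chi2 t) <= N) ->
    forall t, I01 t -> Rabs (T chi1 t - T chi2 t) <= q * N).
  { intros chi1 chi2 N HK1 HK2 HN t Ht.
    assert (Hd : forall i s, (i <= 3)%nat -> I01 s ->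
      Rabs (approx g chi1 i s - approx g chi2 i s) <= Mcoef i * N).
    { intros i s; apply approx_diff_le; [apply HK1|apply HK2|exact HN]. }
    eapply Rle_trans; [apply Hlip; apply HDM; assumption|].
    replace (q * N) with
      (L 0%nat * (Mcoef 0 * N) + L 1%nat * (Mcoef 0 * N)
       + L 2%nat * (Mcoef 1 * N) + L 3%nat * (Mcoef 1 * N)
       + L 4%nat * (Mcoef 2 * N) + L 5%nat * (Mcoef 2 * N)
       + L 6%nat * (Mcoef 3 * N) + L 7%nat * (Mcoef 3 * N))
      by (unfold q, contraction; ring).
    repeat apply Rplus_le_compat; (apply Rmult_le_compat_l; [apply HL; lia|]);
      apply Hd; auto. }
  assert (HK0 : K psi0).
  { split; [exact Hpsi0_cont|]; intros t Ht.
    exact (Rbar_le_trans _ _ _ (le_norm01 psi0 t Ht) Hpsi0_bound). }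
  assert (HK1 : K (psi 1%nat)) by exact (HKT psi0 HK0).
  assert (Hdd : forall t, I01 t -> Rabs (psi 1%nat t - psi 0%nat t) <= dd).
  { intros t Ht; apply (le_real_norm01 (fun t => psi 1%nat t - psi 0%nat t) (M + M));
      [|exact Ht].
    intros s Hs; unfold Rminus; eapply Rle_trans; [apply Rabs_triang|].
    rewrite Rabs_Ropp; apply Rplus_le_compat; [apply HK1|apply HK0]; exact Hs. }
  destruct (contraction_fixpoint T psi q dd M Hq0 (fun k => eq_refl) HK0 HKT HTlip Hdd)
    as [HK [chi [HKchi [Hfix [Herr Huniq]]]]].
  assert (Huk : forall k, _) by exact
    (fun k => approx_Derive01_n a b c d g (psi k) Hg (proj1 (HK k))).
  destruct (approx_Derive01_n a b c d g chi Hg (proj1 HKchi))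
    as [HC4 [HD [HD4 [ua [ub [uc ud]]]]]].
  assert (Hbnd : forall k i, (i <= 3)%nat -> forall t, I01 t ->
    Rabs (Derive01_n (uk k) i t - Derive01_n (approx g chi 0) i t)
    <= Mcoef i * p k * dd).
  { intros k i Hi t Ht; rewrite HD by assumption.
    unfold uk, iter_u; fold psi; rewrite (proj1 (proj2 (Huk k))) by assumption.
    rewrite Rmult_assoc; apply approx_diff_le; auto; [apply HK|apply HKchi]. }
  assert (Hsol : forall t, I01 t ->
    chi t = f (jet phi (Derive01_n (approx g chi 0)) t)).
  { intros t Ht; rewrite <- Hfix by exact Ht; unfold T; f_equal.
    unfold jet; rewrite !HD by auto; reflexivity. }
  split; [intros k; apply Cn01_le with 4%nat; [lia|apply Huk]|].
  exists (approx g chi 0); split; [|split; [|split]].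
  - split.
    + split; [exact HC4|split; [|auto]].
      intros t Ht; rewrite HD4, Hsol by (unfold I01; lra); reflexivity.
    + intros i t Hi Ht; rewrite HD by assumption; apply Happrox; assumption.
  - intros w [[HCw [Hw4 [wa [wb [wc wd]]]]] Hwr] t Ht.
    (* The radius bounds on [w] place its jet in D_M, hence [chi'] in the ball. By the linear
       problem [w] is the function built from [chi'], which makes [chi'] a fixed point. *)
    set (chi' := fun t => f (jet phi (Derive01_n w) t)) in *.
    assert (HKw : K chi').
    { split.
      - apply C01_jet; auto; intros i Hi; apply HCw; lia.
      - intros s Hs; apply Hbound, DM_jet; auto. }
    assert (Hw := Derive01_n_eq_approx a b c d g chi' w Hg (proj1 HKw) HCw Hw4 wa wb wc wd).
    assert (E : forall s, I01 s -> chi' s = chi s).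
    { apply Huniq; [exact HKw|]; intros s Hs; unfold T, chi' at 2; f_equal.
      unfold jet; rewrite !Hw by auto; reflexivity. }
    change (w t) with (Derive01_n w 0 t); rewrite Hw by (auto; lia).
    apply Rminus_diag_uniq.
    (* With [N = 0], densities equal on [0,1] give equal functions. *)
    assert (H := approx_diff_le g chi' chi 0 0 t (proj1 HKw) (proj1 HKchi)).
    rewrite Rmult_0_r in H.
    apply Rabs_eq_0, Rle_antisym; [|apply Rabs_pos].
    apply H; [|lia|exact Ht].
    intros s Hs; rewrite E, Rminus_diag, Rabs_R0 by exact Hs; apply Rle_refl.
  - intros i Hi.
    apply is_lim_seq_le_le with (fun _ => 0) (fun k => q ^ k * (Mcoef i * dd / (1 - q))).
    + intros k; split.
      * eapply Rle_trans; [apply Rabs_pos|].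
        apply (le_real_norm01 (fun t => Derive01_n (uk k) i t
          - Derive01_n (approx g chi 0) i t) (Mcoef i * p k * dd) 0);
          [apply Hbnd, Hi|unfold I01; lra].
      * eapply Rle_trans; [apply real_norm01_le, Hbnd, Hi|].
        right; unfold p; field; lra.
    + apply is_lim_seq_const.
    + apply is_lim_seq_geom_scal, Hq0.
  - intros k i Hi; apply norm01_le, Hbnd, Hi.
Qed.
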